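(* Let $G_1$ and $G_2$ be weighted graphs on a common vertex set $V$, with nodeweights one and edgeweights in $[-1,1]$. Let $k\le|V|$ be a positive integer. If $S$ is chosen uniformly from all subsets of $V$ of size $k$, then $$\bigl|d_\square(G_1[S],G_2[S])-d_\square(G_1,G_2)\bigr|\le\frac{20}{k^{1/4}}$$ with probability at least $1-2e^{-\sqrt k/8}$.
   Context: A weighted graph $G$ with nodeweights one is a finite nonempty node set $V(G)$ together with real symmetric edgeweights $\beta_{ij}(G)$, $i,j\in V(G)$ (loops $i=j$ allowed; $\beta_{ij}=0$ if $ij$ is not an edge). For $A,B\subseteq V(G)$ let $e_G(A,B)=\sum_{i\in A,\,j\in B}\beta_{ij}(G)$. For two such graphs on the same node set $V$, $d_\square(G,G')=\max_{A,B\subseteq V}\frac{1}{|V|^2}|e_G(A,B)-e_{G'}(A,B)|$. $G[S]$ denotes the subgraph of $G$ induced by $S$, with inherited weights (so $d_\square(G_1[S],G_2[S])$ is normalized by $|S|^2=k^2$). *)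

(* Defs.v *)
From HB Require Import structures.
From mathcomp Require Import all_boot all_order all_algebra.
From mathcomp Require Import all_classical all_reals all_analysis.
Set Implicit Arguments.
Unset Strict Implicit.
Unset Printing Implicit Defensive.
Import Order.TTheory GRing.Theory Num.Theory.
Local Open Scope ring_scope.

(* Nonemptiness of the node set is not a field: it is to be assumed of [V]
   where it matters.  A pair which is not an edge has weight 0. *)
Record wgraph (R : realType) (V : finType) := WGraph {
  edgeweight : V -> V -> R;
  edgeweight_sym : forall i j : V, edgeweight i j = edgeweight j i
}.

Definition edge_sum (R : realType) (V : finType) (G : wgraph R V)
    (A B : {set V}) : R :=
  \sum_(i in A) \sum_(j in B) edgeweight G i j.

(* The terms are nonnegative and there is at least one of them, so the default
   value 0 does not affect the maximum. *)
Definition cut_dist (R : realType) (V : finType) (G G' : wgraph R V) : R :=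
  \big[Num.max/0]_(A : {set V}) \big[Num.max/0]_(B : {set V})
    (1 / #|V|%:R ^+ 2 * `|edge_sum G A B - edge_sum G' A B|).

(* The node set is the subtype of the elements of [S], so that [cut_dist]
   of induced subgraphs is normalized by [#|S| ^ 2]. *)
Definition induced_wgraph (R : realType) (V : finType) (G : wgraph R V)
    (S : {set V}) : wgraph R {x : V | x \in S} :=
  @WGraph R {x : V | x \in S}
    (fun i j => edgeweight G (val i) (val j))
    (fun i j => edgeweight_sym G (val i) (val j)).

Definition prob_ksubset (R : realType) (V : finType) (k : nat)
    (E : pred {set V}) : R :=
  #|[set S : {set V} | (#|S| == k) && E S]|%:R
    / #|[set S : {set V} | #|S| == k]|%:R.

(* Main.v *)
(** Let [W] be half the difference of the two weightings and let [max_cut W S] be the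
    one-sided cut norm of its restriction to [S]; it suffices to show that
    [max_cut W S / k ^ 2] deviates from [max_cut W V / n ^ 2] by more than
    [10 / k ^ (1/4)] with probability at most [2 exp (- sqrt k)], and to apply this
    to [W] and [- W].  A uniform [k]-subset is [s @: K] for a fixed [K] and a uniform
    permutation [s] of the nodes.

    Exchanging one node changes [max_cut W S] by at most [2 k], so [max_cut W S]
    concentrates around its mean (exponential moments, exposing [S] node by node).

    The mean is at most [max_cut W V / n ^ 2 + O(1 / sqrt k)]: take independent uniform
    rows [x] and columns [y], [m = k / 2] of each.  By symmetrization and the contraction
    principle for the positive part, applied to the columns and then to the rows,
    the largest rectangle sum of [W (x i) (y j)] has normalized mean at most
    [max_cut W V / n ^ 2 + 4 / sqrt m].  Conversely, up to a random relabelling, [x] and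
    [y] take values in [K]; fixing the optimal rectangle of [s @: K] and averaging, this
    mean is at least that of [max_cut W (s @: K) / k ^ 2], up to collisions of
    probability [1 / n]. *)

Require Import Defs.
From HB Require Import structures.
From mathcomp Require Import all_classical all_reals all_analysis.
From mathcomp Require Import all_boot all_order all_algebra all_fingroup.
From mathcomp Require Import zify ring lra.
Set Implicit Arguments.
Unset Strict Implicit.
Unset Printing Implicit Defensive.
Import Order.TTheory GRing.Theory Num.Theory.
Local Open Scope ring_scope.

(** * Averages and maxima over finite types *)

Definition avg (R : realType) (T : finType) (f : T -> R) : R :=
  (\sum_t f t) / #|T|%:R.

Section Average.
Variables (R : realType) (T : finType).
Implicit Types f g : T -> R.

Lemma eq_avg f g : f =1 g -> avg f = avg g.
Proof. by move=> fg; rewrite /avg (eq_bigr g). Qed.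

Lemma avgD f g : avg (fun t => f t + g t) = avg f + avg g.
Proof. by rewrite /avg big_split mulrDl. Qed.

Lemma avgZ (a : R) f : avg (fun t => a * f t) = a * avg f.
Proof. by rewrite /avg -mulr_sumr mulrA. Qed.

Lemma avgN f : avg (fun t => - f t) = - avg f.
Proof. by rewrite /avg sumrN mulNr. Qed.

Lemma avgB f g : avg (fun t => f t - g t) = avg f - avg g.
Proof. by rewrite avgD avgN. Qed.

Lemma le_avg f g : (forall t, f t <= g t) -> avg f <= avg g.
Proof. by move=> fg; rewrite ler_wpM2r ?invr_ge0 ?ler0n// ler_sum. Qed.

Lemma avg_cst (a : R) : (0 < #|T|)%N -> avg (fun _ : T => a) = a.
Proof.
move=> T0; rewrite /avg sumr_const -[a *+ _]mulr_natr mulfK//.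
by rewrite pnatr_eq0 -lt0n.
Qed.

Lemma avg_le_cst f (a : R) : (0 < #|T|)%N -> (forall t, f t <= a) -> avg f <= a.
Proof. by move=> T0 fa; rewrite -[leRHS](avg_cst a T0); exact: le_avg. Qed.

Lemma avg_ge_cst f (a : R) : (0 < #|T|)%N -> (forall t, a <= f t) -> a <= avg f.
Proof. by move=> T0 fa; rewrite -[leLHS](avg_cst a T0); exact: le_avg. Qed.

Lemma avg_reindex (h : T -> T) f : injective h -> avg (fun t => f (h t)) = avg f.
Proof. by move=> hI; rewrite /avg [in RHS](reindex_inj hI). Qed.

Lemma avg_sum (J : finType) (P : pred J) (F : J -> T -> R) :
  avg (fun t => \sum_(j | P j) F j t) = \sum_(j | P j) avg (F j).
Proof. by rewrite /avg exchange_big mulr_suml. Qed.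

End Average.

Lemma exchange_avg (R : realType) (T U : finType) (F : T -> U -> R) :
  avg (fun t => avg (F t)) = avg (fun u => avg (F^~ u)).
Proof.
rewrite /avg -!mulr_suml exchange_big /=.
by rewrite -!mulrA [X in _ * X]mulrC.
Qed.

Section FiniteMax.
Variables (R : realType) (I : finType) (i0 : I).
Implicit Types F G : I -> R.

(** The witness [i0] makes this a true maximum, attained at some index and with no default value;
    the quantities maximized may be negative. *)
Definition fmax F : R := F [arg max_(i > i0) F i]%O.

Lemma fmax_ub F i : F i <= fmax F.
Proof. by rewrite /fmax; case: arg_maxP => // j _; exact. Qed.

Lemma fmax_le F a : (forall i, F i <= a) -> fmax F <= a.
Proof. exact. Qed.

Lemma le_fmax F G : (forall i, F i <= G i) -> fmax F <= fmax G.
Proof. by move=> FG; apply: fmax_le => i; exact: le_trans (FG i) (fmax_ub _ _). Qed.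

Lemma eq_fmax F G : F =1 G -> fmax F = fmax G.
Proof. by move=> FG; apply/le_anti/andP; split; apply: le_fmax => i; rewrite FG. Qed.

Lemma fmaxD F G : fmax (fun i => F i + G i) <= fmax F + fmax G.
Proof. by apply: fmax_le => i; rewrite lerD ?fmax_ub. Qed.

Lemma fmax_avg (T : finType) (F : I -> T -> R) :
  fmax (fun i => avg (F i)) <= avg (fun t => fmax (F^~ t)).
Proof. by apply: fmax_le => i; apply: le_avg => t; exact: (fmax_ub (F^~ t)). Qed.

End FiniteMax.

(** The largest sum of a function over a subset is the sum of its positive parts, so one side of a
    rectangle can be optimized in closed form. *)
Definition pospart (R : realType) (x : R) : R := Num.max 0 x.

Lemma pospart_ge0 (R : realType) (x : R) : 0 <= pospart x.
Proof. by rewrite le_max lexx. Qed.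

Lemma pospart_ge (R : realType) (x : R) : x <= pospart x.
Proof. by rewrite le_max lexx orbT. Qed.

Lemma pospart_lip (R : realType) (x y : R) : pospart x - pospart y <= `|x - y|.
Proof.
rewrite /pospart; case: (lerP 0 x) => x0; case: (lerP 0 y) => y0;
  by case: (ger0P (x - y)) => xy; lra.
Qed.

Lemma sum_le_pospart (R : realType) (J : finType) (P : pred J) (F : J -> R) :
  \sum_(j | P j) F j <= \sum_j pospart (F j).
Proof.
rewrite big_mkcond ler_sum// => j _.
by case: ifP; rewrite ?pospart_ge0 ?pospart_ge.
Qed.

Lemma sum_pospart (R : realType) (J : finType) (F : J -> R) :
  \sum_j pospart (F j) = \sum_(j in [set j | 0 <= F j]) F j.
Proof.
rewrite [RHS]big_mkcond; apply: eq_bigr => j _.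
by rewrite inE /pospart; case: lerP.
Qed.

(** * Rademacher averages and independent sampling *)

Section Rademacher.
Variables (R : realType) (m : nat).
Implicit Types (e : {ffun 'I_m -> bool}) (c : 'I_m -> R).

Definition rflip (j : 'I_m) e : {ffun 'I_m -> bool} :=
  [ffun i => if i == j then ~~ e i else e i].

Lemma rflipK j : involutive (rflip j).
Proof. by move=> e; apply/ffunP => i; rewrite !ffunE; case: eqP; rewrite ?negbK. Qed.

Lemma avg_rflip j (f : {ffun 'I_m -> bool} -> R) :
  avg f = avg (fun e => (f e + f (rflip j e)) / 2).
Proof.
rewrite -[RHS](eq_avg (f := fun e => 2^-1 * (f e + f (rflip j e)))); last first.
  by move=> e; rewrite mulrC.
rewrite avgZ avgD (avg_reindex f (can_inj (rflipK j))); lra.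
Qed.

Lemma signs_card : (0 < #|{ffun 'I_m -> bool}|)%N.
Proof. by apply/card_gt0P; exists [ffun=> true]. Qed.

Lemma rademacher_sq c :
  avg (fun e => (\sum_j (-1) ^+ e j * c j) ^+ 2) = \sum_j c j ^+ 2.
Proof.
under eq_avg => e do rewrite expr2 mulr_suml.
rewrite avg_sum; apply: eq_bigr => i _.
under eq_avg => e do rewrite mulr_sumr.
rewrite avg_sum (bigD1 i)//= big1 ?addr0 => [|j ji].
  rewrite -[RHS](avg_cst _ signs_card); apply: eq_avg => e.
  by case: (e i); ring.
(* Flipping the sign [i] negates the cross term [(i, j)]. *)
rewrite (avg_rflip i) -[RHS](avg_cst 0 signs_card); apply: eq_avg => e.
by rewrite !ffunE eqxx (negPf ji); case: (e i); rewrite /=; lra.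
Qed.

Lemma rademacher_le c : (forall j, `|c j| <= 1) ->
  avg (fun e => `|\sum_j (-1) ^+ e j * c j|) <= Num.sqrt m%:R.
Proof.
move=> c1; case: (posnP m) => [m0|m0].
  apply: avg_le_cst signs_card _ => e.
  rewrite big1 ?normr0 ?sqrtr_ge0// => j; by move: (ltn_ord j); rewrite {2}m0.
set r := Num.sqrt _; have r0 : 0 < r by rewrite sqrtr_gt0 ltr0n.
have rr : r ^+ 2 = m%:R by rewrite sqr_sqrtr// ler0n.
(* AM-GM: [2 |X| <= X^2 / r + r] *)
apply: (@le_trans _ _ (avg (fun e =>
  (2 * r)^-1 * ((\sum_j (-1) ^+ e j * c j) ^+ 2 + r ^+ 2)))).
  apply: le_avg => e; set S := \sum_j _; rewrite ler_pdivlMl ?mulr_gt0//.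
  rewrite -subr_ge0 -(real_normK (num_real S)).
  set X := `|S|; have -> : X ^+ 2 + r ^+ 2 - 2 * r * X = (X - r) ^+ 2 by ring.
  exact: sqr_ge0.
rewrite avgZ avgD rademacher_sq (avg_cst _ signs_card) ler_pdivrMl ?mulr_gt0//.
have : \sum_j c j ^+ 2 <= m%:R.
  have -> : m%:R = \sum_(j < m) 1 :> R by rewrite sumr_const card_ord.
  apply: ler_sum => j _.
  by rewrite -[leLHS]real_normK ?num_real// expr_le1.
by move: rr; rewrite expr2; nra.
Qed.

Variables (I : finType) (i0 : I).
Implicit Types a : I -> 'I_m -> R.

(** With [i] and [j] maximizing the two terms on the left, [a i - a j] is at most [b i - b j] or
    [b j - b i]; on the right, [i] and [j] are used in this order or exchanged. *)
Lemma contraction_step (u a b : I -> R) :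
    (forall i i', a i - a i' <= `|b i - b i'|) ->
  fmax i0 (fun i => u i + a i) + fmax i0 (fun i => u i - a i) <=
  fmax i0 (fun i => u i + b i) + fmax i0 (fun i => u i - b i).
Proof.
move=> ab; rewrite {1 2}/fmax; set i := (X in u X + a X); set j := (X in u X - a X).
have := ab i j.
have := fmax_ub i0 (fun i => u i + b i) i; have := fmax_ub i0 (fun i => u i - b i) i.
have := fmax_ub i0 (fun i => u i + b i) j; have := fmax_ub i0 (fun i => u i - b i) j.
by case: (ger0P (b i - b j)); lra.
Qed.

(* The Ledoux-Talagrand contraction principle; the coordinates are contracted
   one at a time. *)
Lemma contraction a :
  avg (fun e => fmax i0 (fun i => \sum_j (-1) ^+ e j * pospart (a i j))) <=
  avg (fun e => fmax i0 (fun i => \sum_j (-1) ^+ e j * a i j)).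
Proof.
(* Coordinates below [d] are linear, the others still contracted; [d] runs from 0 to [m]. *)
pose mix d i (j : 'I_m) := if (j < d)%N then a i j else pospart (a i j).
have step d : (d <= m)%N ->
    avg (fun e => fmax i0 (fun i => \sum_j (-1) ^+ e j * mix 0 i j)) <=
    avg (fun e => fmax i0 (fun i => \sum_j (-1) ^+ e j * mix d i j)).
  elim: d => // d IH dm; apply: le_trans (IH (ltnW dm)) _.
  pose j := Ordinal dm; rewrite (avg_rflip j) [leRHS](avg_rflip j).
  apply: le_avg => e; rewrite ler_pM2r ?invr_gt0//.
  (* Both sides are symmetric under [rflip j], so the sign [j] may be taken positive in [e]. *)
  wlog ej : e / e j = false.
    move=> hw; case: (boolP (e j)) => ej; last by apply: hw; exact/negbTE.
    have := hw (rflip j e); rewrite rflipK ![_ + fmax _ (fun i => \sum__ (-1) ^+ e _ * _)]addrC.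
    by apply; rewrite ffunE eqxx ej.
  pose u i := \sum_(l | l != j) (-1) ^+ e l * a i l.
  have E d' i : \sum_l (-1) ^+ e l * mix d' i l =
     (\sum_(l | l != j) (-1) ^+ e l * mix d' i l) + mix d' i j.
    by rewrite (bigD1 j)//= ej mul1r addrC.
  have E' d' i : \sum_l (-1) ^+ (rflip j e) l * mix d' i l =
     (\sum_(l | l != j) (-1) ^+ e l * mix d' i l) - mix d' i j.
    rewrite (bigD1 j)//= ffunE eqxx ej mulN1r addrC; congr (_ + _).
    by apply: eq_bigr => l lj; rewrite ffunE (negPf lj).
  have F i : \sum_(l | l != j) (-1) ^+ e l * mix d.+1 i l =
             \sum_(l | l != j) (-1) ^+ e l * mix d i l.
    apply: eq_bigr => l lj; congr (_ * _); rewrite /mix ltnS leq_eqVlt.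
    by case: (eqVneq (l : nat) d) => // ld; case/eqP: lj; exact: val_inj.
  rewrite !(eq_fmax _ (E _)) !(eq_fmax _ (E' _)).
  under [X in _ <= X + _]eq_fmax => i do rewrite F.
  under [X in _ <= _ + X]eq_fmax => i do rewrite F.
  apply: contraction_step => i i'; rewrite /mix /= ltnn ltnSn.
  exact: pospart_lip.
have := step m (leqnn m).
rewrite (_ : avg _ = avg (fun e => fmax i0 (fun i => \sum_j (-1) ^+ e j * pospart (a i j)))).
  move/le_trans; apply; apply: le_avg => e; apply: le_fmax => i.
  by apply: ler_sum => j _; rewrite /mix ltn_ord.
by apply: eq_avg => e; apply: eq_fmax => i; apply: eq_bigr => j _.
Qed.

End Rademacher.

Lemma avg_pair (R : realType) (T U : finType) (F : T -> U -> R) :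
  avg (fun p : T * U => F p.1 p.2) = avg (fun t => avg (F t)).
Proof.
by rewrite /avg -mulr_suml pair_big /= card_prod natrM invfM -!mulrA [_^-1 * _]mulrC.
Qed.

Section PermutationAverage.
Variables (R : realType) (V : finType).

Lemma perm_card : (0 < #|{perm V}|)%N.
Proof. by apply/card_gt0P; exists 1%g. Qed.

Lemma avg_permM (t : {perm V}) (F : {perm V} -> R) :
  avg (fun s => F (t * s)%g) = avg F.
Proof. exact: avg_reindex (mulgI t). Qed.

(** A transposition shows that the left side does not depend on [v]; averaging over [v] first gives
    the average of [F] for each [s]. *)
Lemma avg_perm1 (F : V -> R) (v : V) : avg (fun s : {perm V} => F (s v)) = avg F.
Proof.
have V0 : (0 < #|V|)%N by apply/card_gt0P; exists v.
have E u : avg (fun s : {perm V} => F (s v)) = avg (fun s : {perm V} => F (s u)).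
  rewrite -(avg_permM (tperm u v)); apply: eq_avg => s.
  by rewrite permM tpermR.
rewrite -[LHS](avg_cst _ V0) (eq_avg E) exchange_avg -[RHS](avg_cst _ perm_card).
by apply: eq_avg => s; exact: avg_reindex perm_inj.
Qed.

End PermutationAverage.

Section IidSampling.
Variables (R : realType) (V : finType) (m : nat).
Hypothesis V0 : (0 < #|V|)%N.
Local Notation sample := {ffun 'I_m -> V}.

Lemma sample_card : (0 < #|{: sample}|)%N.
Proof. by have /card_gt0P[v _] := V0; apply/card_gt0P; exists [ffun=> v]. Qed.

Lemma avg_sample_perm (s : {perm V}) (F : sample -> R) :
  avg (fun y : sample => F [ffun j => s (y j)]) = avg F.
Proof.
apply: avg_reindex => y z /ffunP yz; apply/ffunP => j.
by have := yz j; rewrite !ffunE => /perm_inj.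
Qed.

Lemma avg_sample1 (F : V -> R) (j : 'I_m) :
  avg (fun y : sample => F (y j)) = avg F.
Proof.
rewrite -[LHS](avg_cst _ (perm_card V)).
rewrite (eq_avg (g := fun s : {perm V} => avg (fun y : sample => F (s (y j))))); last first.
  move=> s; rewrite -(avg_sample_perm s); apply: eq_avg => y.
  by rewrite ffunE.
rewrite exchange_avg -[RHS](avg_cst _ sample_card).
by apply: eq_avg => y; rewrite avg_perm1.
Qed.

Variables (I : finType) (i0 : I) (h : I -> V -> R).

(** A ghost sample [y'] represents the means; exchanging [y j] and [y' j] at random inserts signs,
    and subadditivity of the maximum separates the two samples, hence the factor 2. *)
Lemma symmetrization (H : I -> V -> R) :
  avg (fun y : sample => fmax i0 (fun i => \sum_j H i (y j))) <=
  fmax i0 (fun i => m%:R * avg (H i)) +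
  2 * avg (fun y : sample => avg (fun e : {ffun 'I_m -> bool} =>
    fmax i0 (fun i => \sum_j (-1) ^+ e j * H i (y j)))).
Proof.
pose D (e : {ffun 'I_m -> bool}) (p : sample * sample) :=
  fmax i0 (fun i => \sum_j (-1) ^+ e j * (H i (p.1 j) - H i (p.2 j))).
have ghost : avg (fun y : sample => fmax i0 (fun i => \sum_j H i (y j))) <=
    fmax i0 (fun i => m%:R * avg (H i)) + avg (D [ffun=> false]).
  rewrite -[X in X + _](avg_cst _ sample_card).
  rewrite (avg_pair (fun y y' => D [ffun=> false] (y, y'))) -avgD.
  apply: le_avg => y.
  have -> : fmax i0 (fun i => m%:R * avg (H i)) =
      fmax i0 (fun i => avg (fun y' : sample => \sum_j H i (y' j))).
    apply: eq_fmax => i; rewrite avg_sum (eq_bigr (fun=> avg (H i))) => [|j _].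
      by rewrite sumr_const card_ord mulr_natl.
    exact: avg_sample1.
  apply: le_trans (lerD (lexx _) (fmax_avg _ _)).
  apply: le_trans (fmaxD _ _ _); apply: le_fmax => i.
  rewrite -avgD; apply: avg_ge_cst sample_card _ => y'.
  rewrite -big_split; apply: ler_sum => j _.
  by rewrite ffunE /=; lra.
(* Exchanging [y j] and [y' j] where [e j] is true preserves the law of the pair and changes the
   sign of the term [j]. *)
have swap e : avg (D [ffun=> false]) = avg (D e).
  pose f (p : sample * sample) : sample * sample :=
    ([ffun j => if e j then p.2 j else p.1 j], [ffun j => if e j then p.1 j else p.2 j]).
  have fK : involutive f.
    by move=> [y y']; congr (_, _); apply/ffunP => j; rewrite !ffunE /=; case: (e j).
  rewrite -(avg_reindex (D e) (can_inj fK)); apply: eq_avg => p.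
  apply: eq_fmax => i; apply: eq_bigr => j _.
  by rewrite !ffunE /=; case: (e j); rewrite /=; lra.
apply: le_trans ghost _; rewrite lerD2l.
rewrite -[leLHS](avg_cst _ (signs_card m)) (eq_avg swap).
rewrite [X in 2 * X]exchange_avg.
have flip : avg (fun e : {ffun 'I_m -> bool} => avg (fun y : sample =>
     fmax i0 (fun i => \sum_j (-1) ^+ (~~ e j) * H i (y j)))) =
   avg (fun e : {ffun 'I_m -> bool} => avg (fun y : sample =>
     fmax i0 (fun i => \sum_j (-1) ^+ e j * H i (y j)))).
  pose f (e : {ffun 'I_m -> bool}) : {ffun 'I_m -> bool} := [ffun j => ~~ e j].
  have fK : involutive f by move=> e; apply/ffunP => j; rewrite !ffunE negbK.
  rewrite -[RHS](avg_reindex _ (can_inj fK)); apply: eq_avg => e.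
  apply: eq_avg => y; apply: eq_fmax => i; apply: eq_bigr => j _.
  by rewrite ffunE.
rewrite mulr2n mulrDl mul1r -{2}flip -avgD; apply: le_avg => e.
rewrite (avg_pair (fun y y' => D e (y, y'))).
rewrite -[X in _ + X](avg_cst _ sample_card) -avgD; apply: le_avg => y.
rewrite -[X in X + _](avg_cst _ sample_card) -avgD; apply: le_avg => y'.
apply: le_trans (fmaxD _ _ _); apply: le_fmax => i.
rewrite -big_split; apply: ler_sum => j _ /=.
by case: (e j); rewrite /=; lra.
Qed.

Lemma sampling_pospart :
  avg (fun y : sample => fmax i0 (fun i => \sum_j pospart (h i (y j)))) <=
  fmax i0 (fun i => m%:R * avg (fun v => pospart (h i v))) +
  2 * avg (fun y : sample => avg (fun e : {ffun 'I_m -> bool} =>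
    fmax i0 (fun i => \sum_j (-1) ^+ e j * h i (y j)))).
Proof.
apply: le_trans (symmetrization (fun i v => pospart (h i v))) _.
rewrite lerD2l ler_pM2l//; apply: le_avg => y; exact: contraction.
Qed.

End IidSampling.

(** The two sets range over all of [V] and are cut down to [S], so that one index type serves for
    every [S]. Without an absolute value, optimizing one side yields positive parts. *)
Definition max_cut (R : realType) (V : finType) (W : V -> V -> R) (S : {set V}) : R :=
  fmax (set0, set0) (fun p : {set V} * {set V} =>
    \sum_(a in p.1 :&: S) \sum_(b in p.2 :&: S) W a b).

Section TwoSidedSampling.
Variables (R : realType) (V : finType) (W : V -> V -> R).
Hypothesis V0 : (0 < #|V|)%N.
Hypothesis W1 : forall a b, `|W a b| <= 1.

(** Largest rectangle sum of the sampled matrix: given the rows [A], the best columns are those with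
    nonnegative sum. *)
Definition sample_cut (m : nat) (x y : {ffun 'I_m -> V}) : R :=
  fmax set0 (fun A : {set 'I_m} => \sum_j pospart (\sum_(i in A) W (x i) (y j))).

Lemma max_cut_sum_pospart (B : {set V}) :
  \sum_a pospart (\sum_(b in B) W a b) <= max_cut W setT.
Proof.
rewrite sum_pospart; set A := [set _ | _].
apply: le_trans (fmax_ub _ _ (A, B)); rewrite /= !setIT.
exact: lexx.
Qed.

(** Columns are sampled first, at a cost of [2 m sqrt m]; then the rows, at a cost of [2 n sqrt m],
    which the factor [m / n] turns into the same amount ([n = #|V|]). *)
Lemma avg_sample_cut (m : nat) :
  avg (fun x : {ffun 'I_m -> V} => avg (sample_cut x)) <=
  m%:R ^+ 2 * (max_cut W setT / #|V|%:R ^+ 2) + 4 * (m%:R * Num.sqrt m%:R).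
Proof.
have n0 : (0 : R) < #|V|%:R by rewrite ltr0n.
have m0 : (0 : R) <= m%:R by [].
(* Both Rademacher averages reduce to sums of [`|\sum_j (-1) ^+ e j * c j|]. *)
have rad (J : finType) (C : J -> 'I_m -> R) (A : {set J}) (e : {ffun 'I_m -> bool}) :
    \sum_j (-1) ^+ e j * (\sum_(i in A) C i j) <= \sum_i `|\sum_j (-1) ^+ e j * C i j|.
  under eq_bigr => j _ do rewrite mulr_sumr.
  rewrite exchange_big /= [leLHS]big_mkcond ler_sum// => i _.
  by case: ifP => _; rewrite ?normr_ge0 ?ler_norm.
have rad2 (J : finType) (C : J -> 'I_m -> R) : (forall i j, `|C i j| <= 1) ->
    avg (fun e : {ffun 'I_m -> bool} => fmax set0 (fun A : {set J} =>
      \sum_j (-1) ^+ e j * (\sum_(i in A) C i j))) <= #|J|%:R * Num.sqrt m%:R.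
  move=> C1; apply: le_trans (le_avg (g := fun e : {ffun 'I_m -> bool} =>
      \sum_i `|\sum_j (-1) ^+ e j * C i j|) _) _.
    by move=> e; apply: fmax_le => A; exact: rad.
  rewrite avg_sum mulr_natl -sumr_const; apply: ler_sum => i _.
  exact: rademacher_le.
have stage1 (x : {ffun 'I_m -> V}) : avg (sample_cut x) <=
    fmax set0 (fun A : {set 'I_m} => m%:R * avg (fun v => pospart (\sum_(i in A) W (x i) v)))
    + 2 * (m%:R * Num.sqrt m%:R).
  apply: le_trans (@sampling_pospart _ _ m V0 _ set0
    (fun (A : {set 'I_m}) v => \sum_(i in A) W (x i) v)) _.
  rewrite lerD2l ler_pM2l//; apply: avg_le_cst (sample_card m V0) _ => y.
  by rewrite -[m in m%:R * _]card_ord; apply: rad2.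
have stage2 : avg (fun x : {ffun 'I_m -> V} => fmax set0 (fun B : {set V} =>
     \sum_i pospart (\sum_(b in B) W (x i) b))) <=
    m%:R * (max_cut W setT / #|V|%:R) + 2 * (#|V|%:R * Num.sqrt m%:R).
  apply: le_trans (@sampling_pospart _ _ m V0 _ set0
    (fun (B : {set V}) v => \sum_(b in B) W v b)) _.
  apply: lerD.
    apply: fmax_le => B; rewrite ler_wpM2l// /avg ler_wpM2r ?invr_ge0 ?ler0n//.
    exact: max_cut_sum_pospart.
  rewrite ler_pM2l//; apply: avg_le_cst (sample_card m V0) _ => y.
  exact: (rad2 _ (fun b j => W (y j) b)).
(* Once the columns run over all of [V], the optimal ones form a set [B]; fixing it and optimizing
   the rows instead gives the form needed for the second stage. *)
have link (x : {ffun 'I_m -> V}) :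
    fmax set0 (fun A : {set 'I_m} => m%:R * avg (fun v => pospart (\sum_(i in A) W (x i) v)))
    <= m%:R / #|V|%:R * fmax set0 (fun B : {set V} => \sum_i pospart (\sum_(b in B) W (x i) b)).
  apply: fmax_le => A; rewrite /avg [X in _ * X]mulrC mulrA ler_wpM2l ?divr_ge0 ?ler0n//.
  rewrite sum_pospart exchange_big /=; set B := [set _ | _].
  apply: le_trans (fmax_ub _ _ B).
  by rewrite (eq_bigl (mem A)) //; exact: sum_le_pospart.
apply: (@le_trans _ _ (m%:R / #|V|%:R * (m%:R * (max_cut W setT / #|V|%:R) +
    2 * (#|V|%:R * Num.sqrt m%:R)) + 2 * (m%:R * Num.sqrt m%:R))); last first.
  by rewrite le_eqVlt; apply/orP; left; apply/eqP; field; rewrite gt_eqF.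
rewrite -[X in _ <= _ + X](avg_cst _ (sample_card m V0)).
apply: (le_trans (le_avg stage1)); rewrite avgD lerD2r.
apply: (le_trans (le_avg link)); rewrite avgZ ler_wpM2l// divr_ge0//.
Qed.

End TwoSidedSampling.

(** * Expected cut norm of a random subset *)

(** Induction on the size of [A]: if [s] sends all but [a] into [K] and [s a] is outside, then some
    [b] of [K] is still free, and a transposition moves [s a] to [b]. *)
Lemma perm_into (V : finType) (A K : {set V}) :
  (#|A| <= #|K|)%N -> exists s : {perm V}, s @: A \subset K.
Proof.
have [n] := ubnP #|A|; elim: n A => // n IH A; rewrite ltnS => An AK.
have [->|[a aA]] := set_0Vmem A; first by exists 1%g; rewrite imset0 sub0set.
have cA := cardsD1 a A; rewrite aA add1n in cA.
have [||s sK] := IH (A :\ a); first by rewrite -cA.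
  by apply: leq_trans AK; rewrite cA.
have [saK|saK] := boolP (s a \in K).
  by exists s; rewrite -(setD1K aA) imsetU1 subUset sub1set saK.
have /subsetPn[b bK bsA] : ~~ (K \subset s @: (A :\ a)).
  apply/negP => /subset_leq_card; rewrite card_imset; last exact: perm_inj.
  by rewrite leqNgt (leq_trans _ AK)// cA.
exists (s * tperm (s a) b)%g; apply/subsetP => _ /imsetP[c cAa ->]; rewrite permM.
have [->|ca] := eqVneq c a; first by rewrite tpermL.
have scA : s c \in s @: (A :\ a) by apply: imset_f; rewrite !inE ca.
rewrite tpermD ?(subsetP sK)//; first by rewrite (inj_eq perm_inj) eq_sym.
by apply: contraNneq bsA => ->.
Qed.

(** First [tperm u u'], then the image [w] of [v] is moved to [v']; neither [w] nor [v'] is [u'], so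
    the second transposition fixes [u']. *)
Lemma perm_two_points (V : finType) (K : {set V}) (u v u' v' : V) :
    u \in K -> v \in K -> u' \in K -> v' \in K -> v != u -> v' != u' ->
  exists s : {perm V}, [/\ s @: K = K, s u = u' & s v = v'].
Proof.
move=> uK vK u'K v'K vu vu'; pose w := tperm u u' v.
have tK x y : x \in K -> y \in K -> perm_on K (tperm x y).
  move=> xK yK; apply/subsetP => z; rewrite inE.
  by case: tpermP => [->|->|_ _]; rewrite ?eqxx.
have wK : w \in K by rewrite /w perm_closed// tK.
exists (tperm u u' * tperm w v')%g; split.
- by apply: im_perm_on; apply: perm_onM; apply: tK.
- rewrite permM tpermL tpermD// ?vu'//.
  by rewrite /w -[X in _ != X](tpermL u) (inj_eq perm_inj).
- by rewrite permM tpermL.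
Qed.

Section TwoPoints.
Variables (R : realType) (V : finType).
Implicit Types (K S : {set V}) (T : V -> V -> R).

Definition offdiag_sum S T : R := \sum_(a in S) \sum_(b in S | b != a) T a b.

(** A permutation stabilizing [K] carries any ordered pair of distinct points of [K] to any other,
    so all [#|K| * #|K|.-1] off-diagonal terms have the same average, even though [T] depends on
    [s @: K]. *)
Lemma avg_two_points K (T : {set V} -> V -> V -> R) (u v : V) :
    u \in K -> v \in K -> v != u ->
  avg (fun s : {perm V} => offdiag_sum (s @: K) (T (s @: K))) =
  (#|K| * #|K|.-1)%:R * avg (fun s : {perm V} => T (s @: K) (s u) (s v)).
Proof.
move=> uK vK vu.
rewrite (eq_avg (g := fun s : {perm V} => \sum_(a in K) \sum_(b in K | b != a)
   T (s @: K) (s a) (s b))); last first.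
  move=> s; rewrite /offdiag_sum big_imset /=; last by move=> ? ? _ _; exact: perm_inj.
  apply: eq_bigr => a aK; rewrite [LHS]big_mkcondr [RHS]big_mkcondr /=.
  rewrite big_imset /=; last by move=> ? ? _ _; exact: perm_inj.
  by apply: eq_bigr => b bK; rewrite (inj_eq perm_inj).
set X := avg (fun s : {perm V} => T _ (s u) (s v)).
rewrite avg_sum natrM -mulrA mulr_natl -sumr_const; apply: eq_bigr => a aK.
rewrite avg_sum (eq_bigr (fun=> X)) => [|b /andP[bK ba]].
  rewrite sumr_const mulr_natl; congr (_ *+ _).
  rewrite (cardsD1 a K) aK add1n /=.
  by apply: eq_card => b; rewrite !inE andbC.
have [t [tK tu tv]] := perm_two_points uK vK aK bK vu ba.
rewrite /X -[RHS](avg_permM t); apply: eq_avg => s.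
rewrite !permM tu tv; congr (T _ _ _).
by rewrite -{1}tK -imset_comp; apply: eq_imset => z /=; rewrite permM.
Qed.

Lemma sum_offdiag S T : (forall a b, `|T a b| <= 1) ->
  `|\sum_(a in S) \sum_(b in S) T a b - offdiag_sum S T| <= #|S|%:R.
Proof.
move=> T1; rewrite -sumrB -sumr_const.
apply: le_trans (ler_norm_sum _ _ _) _; apply: ler_sum => a aS.
by rewrite (bigD1 a)//= addrK.
Qed.

End TwoPoints.

Section SubsetExpectation.
Variables (R : realType) (V : finType) (W : V -> V -> R).
Hypothesis W1 : forall a b, `|W a b| <= 1.

Definition rect (A B : {set V}) (a b : V) : R := ((a \in A) && (b \in B))%:R * W a b.

Lemma rect_le1 A B a b : `|rect A B a b| <= 1.
Proof. by rewrite /rect; case: (_ && _); rewrite ?mul1r ?mul0r ?normr0. Qed.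

Lemma sum_rect (A B S : {set V}) :
  \sum_(a in A :&: S) \sum_(b in B :&: S) W a b = \sum_(a in S) \sum_(b in S) rect A B a b.
Proof.
rewrite [LHS]big_mkcond [RHS]big_mkcond; apply: eq_bigr => a _.
rewrite inE andbC; have [aS|//] := boolP (a \in S).
have [aA|aA] := boolP (a \in A); last first.
  by rewrite /= big1// => b _; rewrite /rect (negPf aA) mul0r.
rewrite /= [LHS]big_mkcond [RHS]big_mkcond; apply: eq_bigr => b _.
rewrite inE andbC /rect aA /=; case: (b \in S) => //=.
by case: ifP; rewrite ?mul1r ?mul0r.
Qed.

Lemma max_cut_ge (A B S : {set V}) :
  \sum_(a in S) \sum_(b in S) rect A B a b <= max_cut W S.
Proof. by rewrite -sum_rect; exact: (fmax_ub _ _ (A, B)). Qed.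

Lemma max_cut_ex (S : {set V}) :
  exists AB : {set V} * {set V},
    max_cut W S = \sum_(a in S) \sum_(b in S) rect AB.1 AB.2 a b.
Proof.
by rewrite /max_cut /fmax; set p := Order.arg_max _ _ _; exists p; rewrite sum_rect.
Qed.

Lemma max_cut_ge0 (S : {set V}) : 0 <= max_cut W S.
Proof.
apply: le_trans (max_cut_ge set0 set0 S); rewrite big1// => a _.
by rewrite big1// => b _; rewrite /rect inE mul0r.
Qed.

Lemma max_cut_le (S : {set V}) : max_cut W S <= #|S|%:R ^+ 2.
Proof.
have [p ->] := max_cut_ex S; apply: le_trans (ler_norm _) _.
apply: le_trans (ler_norm_sum _ _ _) _.
rewrite expr2 mulr_natl -sumr_const; apply: ler_sum => a _.
apply: le_trans (ler_norm_sum _ _ _) _.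
rewrite -sumr_const; apply: ler_sum => b _; exact: rect_le1.
Qed.

Lemma sample_cut_ge (m : nat) (A B : {set V}) (x y : {ffun 'I_m -> V}) :
  \sum_i \sum_j rect A B (x i) (y j) <= sample_cut W x y.
Proof.
apply: le_trans (fmax_ub _ _ [set i | x i \in A]).
rewrite exchange_big; apply: ler_sum => j _ /=.
have [yB|yB] := boolP (y j \in B).
  apply: le_trans (pospart_ge _); rewrite [leRHS]big_mkcond /=.
  apply: ler_sum => i _; rewrite inE /rect yB andbT.
  by case: ifP; rewrite ?mul1r ?mul0r.
rewrite big1 ?pospart_ge0// => i _.
by rewrite /rect (negPf yB) andbF mul0r.
Qed.

Variables (K : {set V}).
Hypothesis K2 : (1 < #|K|)%N.

Local Notation k := (#|K|%:R : R).
Let k2 : 2 <= k. Proof. by rewrite ler_nat. Qed.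
Let k0 : 0 < k. Proof. by have := k2; lra. Qed.
Let k10 : 0 < k - 1. Proof. by have := k2; lra. Qed.
Local Notation n := (#|V|%:R : R).
Let kn : k <= n. Proof. by rewrite ler_nat max_card. Qed.
Let kE : (#|K| * #|K|.-1)%:R = k * (k - 1).
Proof. by rewrite natrM -subn1 natrB// ltnW. Qed.
Let card_imK (s : {perm V}) : #|s @: K| = #|K|.
Proof. by rewrite card_imset//; exact: perm_inj. Qed.
Let V0 : (0 < #|V|)%N.
Proof. by apply: leq_trans (max_card K); exact: ltnW. Qed.

Local Notation E := (avg (fun s : {perm V} => max_cut W (s @: K))).

Let E_ge0 : 0 <= E.
Proof. by apply: avg_ge_cst (perm_card V) _ => s; exact: max_cut_ge0. Qed.

(* [(E - k) / (k * (k - 1)) >= E / k ^ 2 - 2 / k], without the divisions *)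
Let offdiag_normalization (e l D : R) : 0 <= e -> 2 <= l -> e - l <= l * (l - 1) * D ->
  e / l ^+ 2 - 2 / l <= D.
Proof.
move=> e0 l2 h; have l0 : 0 < l by lra.
have L0 : 0 < l * (l - 1) by rewrite mulr_gt0//; lra.
have hD : (e - l) / (l * (l - 1)) <= D by rewrite ler_pdivrMr// mulrC.
apply: le_trans hD; rewrite -subr_ge0.
have -> : (e - l) / (l * (l - 1)) - (e / l ^+ 2 - 2 / l) =
          (e + l * (l - 2)) / (l ^+ 2 * (l - 1)).
  by field; rewrite !gt_eqF//; lra.
by apply: divr_ge0; [rewrite addr_ge0// mulr_ge0//; lra|
  rewrite mulr_ge0 ?exprn_ge0//; lra].
Qed.

(** [D] is the mean weight, within the optimal rectangle of [s @: K], of two distinct random points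
    of [s @: K]; it is at least [E / k ^ 2 - 2 / k]. Two samples take at most [2 m] values, so they
    can be moved into [K]; then each entry has mean [D] unless [x i = y j]. *)
Lemma max_cut_subset_le (m : nat) : (m + m <= #|K|)%N ->
  m%:R ^+ 2 * (E / k ^+ 2 - 4 / k) <=
  avg (fun x : {ffun 'I_m -> V} => avg (sample_cut W x)).
Proof.
move=> mK.
have ex S : exists AB : {set V} * {set V},
    max_cut W S == \sum_(a in S) \sum_(b in S) rect AB.1 AB.2 a b.
  by have [p ->] := max_cut_ex S; exists p.
(* The choice depends on the set [S] alone, as [avg_two_points] requires. *)
pose AB (S : {set V}) := xchoose (ex S).
pose T (S : {set V}) := rect (AB S).1 (AB S).2.
have TE S : max_cut W S = \sum_(a in S) \sum_(b in S) T S a b.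
  exact/eqP/(xchooseP (ex S)).
have /card_gt1P[u [v [uK vK uv]]] := K2; rewrite eq_sym in uv.
pose D := avg (fun s : {perm V} => T (s @: K) (s u) (s v)).
have D1 : D <= 1.
  by apply: avg_le_cst (perm_card V) _ => s; apply: le_trans (ler_norm _) (rect_le1 _ _ _ _).
have ED : E - k <= k * (k - 1) * D.
  rewrite -kE -(avg_two_points T uK vK uv) -[k](avg_cst _ (perm_card V)) -avgB.
  apply: le_avg => s; rewrite TE.
  have := @sum_offdiag _ _ (s @: K) (T (s @: K)) (rect_le1 _ _).
  by rewrite card_imK  ler_norml => /andP[_]; lra.
(* On the diagonal the weight is only known to be at least -1, and [D - 2 <= -1]. *)
have DD a b : a \in K -> b \in K ->
    D - 2 * (a == b)%:R <= avg (fun s : {perm V} => T (s @: K) (s a) (s b)).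
  move=> aK bK; have [<-|ab] := eqVneq a b.
    apply: (@le_trans _ _ (-1)); first by rewrite mulr1; lra.
    apply: avg_ge_cst (perm_card V) _ => s.
    by have := rect_le1 (AB (s @: K)).1 (AB (s @: K)).2 (s a) (s a); rewrite ler_norml => /andP[].
  rewrite mulr0 subr0 /D.
  have := avg_two_points T aK bK; rewrite eq_sym ab => /(_ isT).
  rewrite (avg_two_points T uK vK uv) kE => /mulfI -> //.
  by rewrite mulf_neq0 ?gt_eqF.
have sym : avg (fun x : {ffun 'I_m -> V} => avg (sample_cut W x)) =
    avg (fun x : {ffun 'I_m -> V} => avg (fun y : {ffun 'I_m -> V} =>
      avg (fun s : {perm V} => sample_cut W [ffun i => s (x i)] [ffun i => s (y i)]))).
  under [RHS]eq_avg => x do rewrite exchange_avg.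
  rewrite exchange_avg -[LHS](avg_cst _ (perm_card V)); apply: eq_avg => s.
  rewrite -(avg_sample_perm s); apply: eq_avg => x.
  by rewrite -(avg_sample_perm s).
have pt (x y : {ffun 'I_m -> V}) : \sum_i \sum_j (D - 2 * (x i == y j)%:R) <=
    avg (fun s : {perm V} => sample_cut W [ffun i => s (x i)] [ffun i => s (y i)]).
  have [|t tK] := @perm_into V ((x @: setT) :|: (y @: setT)) K.
    apply: leq_trans mK; apply: leq_trans (leq_card_setU _ _) _.
    by apply: leq_add; apply: leq_trans (leq_imset_card _ _) _; rewrite cardsT card_ord.
  have xK i : t (x i) \in K.
    by apply: (subsetP tK); rewrite imset_f// inE imset_f.
  have yK i : t (y i) \in K.
    by apply: (subsetP tK); rewrite imset_f// inE orbC imset_f.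
  rewrite -(avg_permM t).
  apply: (@le_trans _ _ (avg (fun s : {perm V} =>
     \sum_i \sum_j T (s @: K) (s (t (x i))) (s (t (y j)))))); last first.
    apply: le_avg => s; apply: le_trans (sample_cut_ge (AB (s @: K)).1 (AB (s @: K)).2 _ _).
    by apply: ler_sum => i _; apply: ler_sum => j _; rewrite !ffunE !permM.
  rewrite avg_sum; apply: ler_sum => i _; rewrite avg_sum; apply: ler_sum => j _.
  by have := DD _ _ (xK i) (yK j); rewrite (inj_eq perm_inj).
rewrite sym.
(* A collision [x i = y j] has probability [1 / n <= 1 / k] and costs 2; with the diagonal, the
   losses add up to [4 / k]. *)
apply: (@le_trans _ _ (m%:R ^+ 2 * (D - 2 / n))).
  rewrite ler_wpM2l ?exprn_ge0//.
  have := offdiag_normalization E_ge0 k2 ED.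
  have : 2 / n <= 2 / k by rewrite ler_pM2l// lef_pV2 ?posrE// (lt_le_trans k0).
  lra.
have sc := sample_card m V0.
rewrite -[leLHS](avg_cst _ sc); apply: le_avg => x.
apply: le_trans (le_avg (pt x)).
rewrite avg_sum expr2 -mulrA mulr_natl -[X in _ *+ X](card_ord m) -sumr_const.
apply: ler_sum => i _; rewrite avg_sum mulr_natl -[X in _ *+ X](card_ord m) -sumr_const.
apply: ler_sum => j _; rewrite avgB (avg_cst D sc) lerB// avgZ ler_pM2l//.
rewrite (avg_sample1 V0 (fun v => (x i == v)%:R)) /avg.
rewrite (bigD1 (x i))//= big1 ?eqxx ?addr0 ?mul1r// => b bx.
by rewrite eq_sym (negPf bx).
Qed.

(** One optimal rectangle of [V] is restricted to [s @: K]; its mean weight [X] on two distinct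
    random points is the same for [V] and for [s @: K]. Each passage between [X] and a normalized
    sum costs at most [2 / k]. *)
Lemma max_cut_subset_ge : max_cut W setT / n ^+ 2 - 4 / k <= E / k ^+ 2.
Proof.
have [[A B] /= MT] := max_cut_ex setT.
have /card_gt1P[u [v [uK vK uv]]] := K2; rewrite eq_sym in uv.
pose X := avg (fun s : {perm V} => rect A B (s u) (s v)).
have X1 : X <= 1.
  by apply: avg_le_cst (perm_card V) _ => s; apply: le_trans (ler_norm _) (rect_le1 _ _ _ _).
have nE : (#|[set: V]| * #|[set: V]|.-1)%:R = n * (n - 1).
  by rewrite cardsT natrM -subn1 natrB.
have n2 : 2 <= n := le_trans k2 kn.
have XT : max_cut W setT - n <= n * (n - 1) * X.
  rewrite -nE -(avg_two_points (fun=> rect A B) (in_setT u) (in_setT v) uv).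
  apply: avg_ge_cst (perm_card V) _ => s.
  have -> : s @: [set: V] = setT.
    by apply/setP => b; rewrite inE; apply/imsetP; exists ((s^-1)%g b); rewrite ?permKV.
  have := @sum_offdiag _ _ setT _ (rect_le1 A B).
  by rewrite -MT cardsT  ler_norml => /andP[_]; lra.
have XE : k * (k - 1) * X - k <= E.
  rewrite -kE -(avg_two_points (fun=> rect A B) uK vK uv) -[X in _ - X](avg_cst _ (perm_card V)).
  rewrite -avgB; apply: le_avg => s; apply: le_trans (max_cut_ge A B _).
  have := @sum_offdiag _ _ (s @: K) _ (rect_le1 A B).
  by rewrite card_imK  ler_norml => /andP[]; lra.
have h1 := offdiag_normalization (max_cut_ge0 setT) n2 XT.
have h2 : 2 / n <= 2 / k by rewrite ler_pM2l// lef_pV2 ?posrE// (lt_le_trans k0).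
suff : X - 2 / k <= E / k ^+ 2 by lra.
rewrite ler_pdivlMr ?exprn_gt0//.
have -> : (X - 2 / k) * k ^+ 2 = k ^+ 2 * X - 2 * k by field; rewrite gt_eqF.
by have := k2; nra.
Qed.

End SubsetExpectation.

(** * Concentration *)

(* [expR y = 1 / expR (- y / 2) ^ 2 <= 1 / (1 - y / 2) ^ 2] *)
Lemma expR_le_quadratic (R : realType) (y : R) :
  `|y| <= 3 / 8 -> expR y <= 1 + y + y ^+ 2.
Proof.
rewrite ler_norml => /andP[y1 y2].
have h := expR_ge1Dx (- (y / 2)); have p : 0 < 1 - y / 2 by lra.
have q : 0 < expR (- (y / 2)) := expR_gt0 _.
have -> : expR y = (expR (- (y / 2)) ^+ 2)^-1.
  by rewrite -expRM_natl -expRN; congr expR; lra.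
apply: (@le_trans _ _ (((1 - y / 2) ^+ 2)^-1)).
  by rewrite lef_pV2 ?posrE ?exprn_gt0// ler_pXn2r ?nnegrE ?(ltW p) ?(ltW q).
rewrite -[leLHS]mul1r ler_pdivrMr ?exprn_gt0//.
have -> : (1 + y + y ^+ 2) * (1 - y / 2) ^+ 2 =
   1 + y ^+ 2 * (y ^+ 2 - 3 * y + 1) / 4 by field.
rewrite lerDl divr_ge0// mulr_ge0 ?sqr_ge0//.
by have := sqr_ge0 y; nra.
Qed.

Lemma avg_perm_card (R : realType) (V : finType) (f : {set V} -> R) (S K : {set V}) :
  #|S| = #|K| ->
  avg (fun s : {perm V} => f (s @: S)) = avg (fun s : {perm V} => f (s @: K)).
Proof.
move=> SK; have [|t tS] := @perm_into V S K; first by rewrite SK.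
have {}tS : t @: S = K.
  by apply/eqP; rewrite eqEcard tS (card_imset _ (@perm_inj _ t)) SK leqnn.
rewrite -[RHS](avg_permM t^-1%g); apply: eq_avg => s; congr f.
rewrite -tS -imset_comp; apply: eq_imset => z /=.
by rewrite permM permK.
Qed.

Section Extension.
Variables (R : realType) (V : finType).
Implicit Types (T S : {set V}) (f g : {set V} -> R).

(* Expectation of [f (T :|: U)] for [U] a uniform [j]-subset of [~: T]. *)
Fixpoint ext_avg (j : nat) T f : R :=
  if j is j'.+1 then (\sum_(x in ~: T) ext_avg j' (x |: T) f) / #|~: T|%:R else f T.

Let ext_pos j T : (#|T| + j.+1 <= #|V|)%N -> (0 : R) < #|~: T|%:R.
Proof.
move=> Tj; rewrite ltr0n -(ltn_add2l #|T|) cardsC addn0.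
by apply: leq_trans Tj; rewrite addnS ltnS leq_addr.
Qed.

Let ext_card j T x : x \in ~: T -> (#|x |: T| + j = #|T| + j.+1)%N.
Proof. by rewrite inE => xT; rewrite cardsU1 xT add1n addSnnS. Qed.

Lemma le_ext_avg j T f g : (#|T| + j <= #|V|)%N ->
    (forall S, #|S| = (#|T| + j)%N -> f S <= g S) ->
  ext_avg j T f <= ext_avg j T g.
Proof.
elim: j T => [|j IH] T Tj fg /=; first by apply: fg; rewrite addn0.
rewrite ler_pM2r ?invr_gt0 ?(ext_pos Tj)//; apply: ler_sum => x xT.
by apply: IH => [|S]; rewrite (ext_card _ xT)//; exact: fg.
Qed.

Lemma ext_avg_cst j T (a : R) : (#|T| + j <= #|V|)%N -> ext_avg j T (fun=> a) = a.
Proof.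
elim: j T => [//|j IH] T Tj /=.
rewrite (eq_bigr (fun=> a)) => [|x xT]; last by rewrite IH// (ext_card _ xT).
by rewrite sumr_const -[a *+ _]mulr_natr mulfK// gt_eqF// (ext_pos Tj).
Qed.

Lemma ext_avgB j T f g :
  ext_avg j T (fun S => f S - g S) = ext_avg j T f - ext_avg j T g.
Proof.
elim: j T => [//|j IH] T /=.
by rewrite -mulrBl -sumrB; congr (_ / _); apply: eq_bigr => x _; exact: IH.
Qed.

Lemma ext_avg_avg (U : finType) j T (F : {set V} -> U -> R) :
  ext_avg j T (fun S => avg (F S)) = avg (fun u => ext_avg j T (F^~ u)).
Proof.
elim: j T => [//|j IH] T /=.
rewrite (eq_bigr _ (fun x _ => IH _)) -avg_sum /avg -!mulr_suml.
by rewrite -!mulrA [X in _ * X]mulrC.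
Qed.

Lemma ext_avg_perm j T f (s : {perm V}) :
  ext_avg j (s @: T) f = ext_avg j T (fun S => f (s @: S)).
Proof.
elim: j T => [//|j IH] T /=.
have sC : ~: (s @: T) = s @: (~: T).
  apply/setP => y; rewrite inE -(permKV s y).
  by rewrite !(mem_imset _ _ (@perm_inj _ s)) inE.
rewrite sC card_imset; last exact: perm_inj.
rewrite big_imset /=; last by move=> ? ? _ _; exact: perm_inj.
by congr (_ / _); apply: eq_bigr => x _; rewrite -IH imsetU1.
Qed.

(** Exposure from the empty set commutes with relabelling, so a random relabelling may be inserted;
    once averaged over it, [f] depends only on the size of the set. *)
Lemma ext_avg_uniform (K : {set V}) f :
  ext_avg #|K| set0 f = avg (fun s : {perm V} => f (s @: K)).
Proof.
have K0 : (#|(set0 : {set V})| + #|K| <= #|V|)%N by rewrite cards0 max_card.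
rewrite -[LHS](avg_cst _ (perm_card V)).
rewrite (eq_avg (g := fun s : {perm V} => ext_avg #|K| set0 (fun S => f (s @: S)))).
  rewrite -ext_avg_avg -[RHS](ext_avg_cst _ K0).
  by apply/le_anti/andP; split; apply: le_ext_avg => // S;
    rewrite cards0 => SK; rewrite (avg_perm_card f SK).
by move=> s; rewrite -ext_avg_perm imset0.
Qed.

Variables (g : {set V} -> R) (c : R) (k : nat).
Hypothesis c38 : c <= 3 / 8.
Hypothesis g_swap : forall S x y, #|S| = k -> `|g (tperm x y @: S) - g S| <= c.

(** The transposition of [x] and [y] fixes [T] and couples the extensions of [y |: T] with those of
    [x |: T]; coupled sets differ by one swap. *)
Let ext_avg_swap j T x y : (#|T| + j.+1 = k)%N -> (k <= #|V|)%N ->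
    x \in ~: T -> y \in ~: T ->
  ext_avg j (x |: T) g - ext_avg j (y |: T) g <= c.
Proof.
move=> Tk kV xT yT.
have -> : x |: T = tperm x y @: (y |: T).
  rewrite imsetU1 tpermR; congr (_ |: _).
  rewrite -[LHS]imset_id; apply: eq_in_imset => z zT.
  by rewrite tpermD//; apply: contraTneq zT => <-; rewrite -in_setC.
have yk : (#|y |: T| + j)%N = k by rewrite (ext_card _ yT).
rewrite ext_avg_perm -ext_avgB -[leRHS](@ext_avg_cst j (y |: T)) ?yk//.
apply: le_ext_avg; rewrite ?yk// => S Sk.
by apply: le_trans (ler_norm _) (g_swap _ _ Sk).
Qed.

(** An Azuma-Hoeffding argument: exposing one node moves the conditional mean by at most [c], so the
    linear term averages out and each exposure costs a factor [1 + c ^ 2 <= expR (c ^ 2)]. *)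
Lemma ext_avg_mgf j T : (#|T| + j = k)%N -> (k <= #|V|)%N ->
  ext_avg j T (fun S => expR (g S)) <= expR (ext_avg j T g + j%:R * c ^+ 2).
Proof.
move=> + kV; elim: j T => [|j IH] T Tk /=; first by rewrite mul0r addr0.
have N0 : (0 : R) < #|~: T|%:R by apply: (@ext_pos j); rewrite Tk.
set N : R := #|~: T|%:R in N0 *.
pose M x := ext_avg j (x |: T) g; pose mu := (\sum_(x in ~: T) M x) / N.
have muE : \sum_(x in ~: T) M x = N * mu by rewrite /mu mulrC divfK ?gt_eqF.
have cstE (a : R) : \sum_(x in ~: T) a = N * a by rewrite sumr_const mulr_natl.
have dev x : x \in ~: T -> `|M x - mu| <= c.
  move=> xT; rewrite ler_norml; apply/andP; split.
  - rewrite -(ler_pM2l N0) mulrBr -muE -!cstE -sumrB; apply: ler_sum => y yT.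
    by rewrite lerNl opprB; exact: ext_avg_swap.
  - rewrite -(ler_pM2l N0) mulrBr -muE -!cstE -sumrB; apply: ler_sum => y yT.
    exact: ext_avg_swap.
rewrite -/(\sum_(x in ~: T) M x) -/mu ler_pdivrMr// mulrC.
apply: (@le_trans _ _ (\sum_(x in ~: T) expR (mu + j%:R * c ^+ 2) *
    (1 + (M x - mu) + c ^+ 2))).
  apply: ler_sum => x xT; apply: le_trans (IH _ _) _; first by rewrite (ext_card _ xT).
  rewrite -/(M x) -[M x in leLHS](subrKC mu) addrAC expRD ler_pM2l ?expR_gt0//.
  apply: le_trans (expR_le_quadratic (le_trans (dev _ xT) c38)) _.
  rewrite lerD2l -[leLHS]real_normK ?num_real// ler_pXn2r ?nnegrE ?dev//.
  exact: le_trans (dev _ xT).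
rewrite -mulr_sumr big_split big_split /= sumrB muE !cstE mulr1 subrr addr0.
rewrite -[X in _ * (X + _)]mulr1 -mulrDr mulrCA ler_pM2l//.
rewrite [leRHS](_ : _ = expR (mu + j%:R * c ^+ 2) * expR (c ^+ 2)).
  by rewrite ler_pM2l ?expR_gt0// expR_ge1Dx.
by rewrite -expRD -addrA -natr1 mulrDl mul1r.
Qed.

(** Markov's inequality for [expR (g S)]; the usual free parameter is absorbed in the scale of
    [g]. *)
Lemma subset_tail (K : {set V}) (t : R) : #|K| = k ->
  avg (fun s : {perm V} =>
    (avg (fun s' : {perm V} => g (s' @: K)) + t <= g (s @: K))%R%:R) <=
  expR (k%:R * c ^+ 2 - t).
Proof.
move=> Kk; set m := avg (fun s' : {perm V} => g (s' @: K)).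
have := @ext_avg_mgf k set0; rewrite cards0 -Kk max_card => /(_ erefl isT).
rewrite !ext_avg_uniform -/m => h.
apply: (@le_trans _ _ (avg (fun s : {perm V} => expR (- (m + t)) * expR (g (s @: K))))).
  apply: le_avg => s; rewrite -expRD; case: (boolP (m + t <= g (s @: K))) => [h'|_].
    by apply: le_trans (expR_ge1Dx _); rewrite /= lerDl addrC subr_ge0.
  exact: expR_ge0.
rewrite avgZ; apply: le_trans (ler_wpM2l (expR_ge0 _) h) _.
by rewrite -expRD ler_expR; lra.
Qed.

End Extension.

Section MaxCutSwap.
Variables (R : realType) (V : finType) (W : V -> V -> R).
Hypothesis W1 : forall a b, `|W a b| <= 1.

Lemma max_cut_mono (S S' : {set V}) : S' \subset S -> max_cut W S' <= max_cut W S.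
Proof.
move=> /setIidPl SS; apply: fmax_le => -[A B] /=.
apply: le_trans (fmax_ub _ _ (A :&: S', B :&: S')) => /=.
by rewrite -!setIA SS.
Qed.

(** Only the row and the column of [z] are lost, each with at most [#|S|] entries bounded by 1. *)
Lemma max_cutD1 (S : {set V}) (z : V) :
  max_cut W S <= max_cut W (S :\ z) + 2 * #|S|%:R.
Proof.
have [zS|zS] := boolP (z \in S); last first.
  by rewrite ler_wpDr ?mulr_ge0// max_cut_mono// subsetD1 subxx.
have [[A B] -> /=] := max_cut_ex W S; set T := rect W A B.
have T1 a b : T a b <= 1 by apply: le_trans (ler_norm _) (rect_le1 W1 _ _ _ _).
rewrite (big_setD1 z zS) /=.
have h1 : \sum_(b in S) T z b <= #|S|%:R.
  by rewrite -sumr_const; apply: ler_sum => b _.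
have h2 : \sum_(a in S :\ z) \sum_(b in S) T a b <=
    \sum_(a in S :\ z) 1 + \sum_(a in S :\ z) \sum_(b in S :\ z) T a b.
  by rewrite -big_split; apply: ler_sum => a _; rewrite (big_setD1 z zS) /= lerD2r.
have h3 : \sum_(a in S :\ z) (1 : R) <= #|S|%:R.
  by rewrite sumr_const ler_nat subset_leq_card// subD1set.
have := max_cut_ge W A B (S :\ z); rewrite -/T; lra.
Qed.

Lemma max_cut_swap (S : {set V}) (x y : V) :
  `|max_cut W (tperm x y @: S) - max_cut W S| <= 2 * #|S|%:R.
Proof.
have oneside (S' : {set V}) : max_cut W S' <= max_cut W (tperm x y @: S') + 2 * #|S'|%:R.
  (* Removing one node from [S'] leaves a subset of its image: [x] if it lies in [S'], and [y]
     otherwise. *)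
  suff [z zS] : exists z, S' :\ z \subset tperm x y @: S'.
    by apply: le_trans (max_cutD1 _ z) _; rewrite lerD2r max_cut_mono.
  have fx w : w \in S' -> w != x -> w != y -> w \in tperm x y @: S'.
    by move=> wS wx wy; apply/imsetP; exists w; rewrite // tpermD// eq_sym.
  have [xS|xS] := boolP (x \in S').
    exists x; apply/subsetP => w; rewrite !inE => /andP[wx wS].
    have [->|wy] := eqVneq w y; last exact: fx.
    by apply/imsetP; exists x; rewrite ?tpermL.
  exists y; apply/subsetP => w; rewrite !inE => /andP[wy wS].
  by apply: fx => //; apply: contraTneq wS => ->.
rewrite ler_norml lerBrDr lerBlDr; apply/andP; split.
  by have := oneside S; lra.
have tt : tperm x y @: (tperm x y @: S) = S.
  by rewrite -imset_comp -[RHS]imset_id; apply: eq_imset => z /=; rewrite tpermK.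
have := oneside (tperm x y @: S); rewrite tt card_imset; last exact: perm_inj.
by rewrite addrC.
Qed.

End MaxCutSwap.

Section MaxCutDeviation.
Variables (R : realType) (V : finType) (W : V -> V -> R) (K : {set V}) (r : R).
Hypothesis W1 : forall a b, `|W a b| <= 1.
Hypothesis r10 : 10 <= r.
Hypothesis rK : r ^+ 4 = #|K|%:R.

Local Notation mean := (avg (fun s : {perm V} => max_cut W (s @: K))).

(** For [r >= 10] the errors [4 / k] and [4 / sqrt m] are each at most [1 / r]: here [k = r ^ 4] is
    the size of [K], and [m >= k / 4] gives [sqrt m >= r ^ 2 / 2]. *)
Lemma max_cut_mean :
  `|mean / #|K|%:R ^+ 2 - max_cut W setT / #|V|%:R ^+ 2| <= 6 / r.
Proof.
have r0 : 0 < r by have := r10; lra.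
have k100 : 100 <= #|K|%:R :> R.
  rewrite -rK; have : 10 <= r ^+ 2 by have := r10; rewrite expr2; nra.
  by rewrite -[4%N]/(2 * 2)%N exprM [(_ ^+ 2) ^+ 2]expr2; nra.
have kN : (100 <= #|K|)%N by rewrite -(ler_nat R).
have K2 : (1 < #|K|)%N by apply: leq_trans kN.
have V0 : (0 < #|V|)%N by apply: leq_trans (max_card K); apply: leq_trans kN.
have k4 : 4 / #|K|%:R <= 1 / r.
  rewrite -rK ler_pdivrMr ?exprn_gt0// -[4%N]/(1 + 3)%N exprD expr1 mulrA divfK ?gt_eqF//.
  have : 10 <= r ^+ 2 by have := r10; rewrite expr2; nra.
  by have := r10; rewrite mul1r exprS; nra.
have lo := max_cut_subset_ge W1 K2.
pose m := #|K|./2; have mK : (m + m <= #|K|)%N by rewrite addnn -[leqRHS]odd_double_half leq_addl.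
have up := le_trans (max_cut_subset_le W1 K2 mK) (avg_sample_cut V0 W1 m).
have m4 : (#|K|%:R : R) <= 4 * m%:R.
  rewrite -natrM ler_nat; have := odd_double_half #|K|; rewrite -/m -muln2.
  by move: kN; case: (odd _); lia.
have m0 : (0 : R) < m%:R by lra.
set q : R := Num.sqrt m%:R in up.
have qq : q ^+ 2 = m%:R by rewrite sqr_sqrtr ?ltW.
have q0 : 0 < q by rewrite sqrtr_gt0.
have qr : r ^+ 2 <= 2 * q.
  rewrite -(ler_pXn2r (_ : 0 < 2)%N) ?nnegrE ?exprn_ge0 ?mulr_ge0 ?(ltW r0) ?(ltW q0)//.
  by rewrite -exprM rK exprMn qq -natrX.
have q4 : 4 / q <= 1 / r.
  rewrite ler_pdivrMr// mulrAC mul1r ler_pdivlMr//.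
  by have := r10; move: qr; rewrite expr2; nra.
rewrite ler_norml; apply/andP; split.
  have : 1 / r <= 6 / r by rewrite ler_pM2r ?invr_gt0//; lra.
  lra.
have : mean / #|K|%:R ^+ 2 - 4 / #|K|%:R <= max_cut W setT / #|V|%:R ^+ 2 + 4 / q.
  rewrite -(ler_pM2l (exprn_gt0 2 m0)); apply: le_trans up _.
  rewrite mulrDr lerD2l -qq le_eqVlt; apply/orP; left; apply/eqP.
  by field; rewrite gt_eqF.
have : 6 / r = 6 * (1 / r) by rewrite mul1r.
have : 0 < 1 / r by rewrite divr_gt0.
lra.
Qed.

(** The threshold [10 / r] is split as [6 / r] for the mean and [4 / r] for the fluctuation around
    it. *)
Lemma max_cut_deviation :
  avg (fun s : {perm V} => (10 / r < `|max_cut W (s @: K) / #|K|%:R ^+ 2 -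
    max_cut W setT / #|V|%:R ^+ 2|)%R%:R) <= 2 * expR (- r ^+ 2).
Proof.
have r0 : 0 < r by have := r10; lra.
have := max_cut_mean; set M := max_cut W setT / _; set k : R := #|K|%:R => Mm.
have kE : k = r ^+ 4 by rewrite rK.
(* With this scale a swap changes [l * max_cut] by at most [2 k l = 1 / r]. For [c = 1 / r] one has
   [k c ^ 2 = r ^ 2], so the threshold [2 r ^ 2], which is [4 / r] after normalization, leaves
   [expR (- r ^ 2)]. *)
pose l : R := (2 * r ^+ 5)^-1; have l0 : 0 < l by rewrite invr_gt0 mulr_gt0 ?exprn_gt0.
have c38 : r^-1 <= 3 / 8.
  rewrite -[3 / 8]invf_div lef_pV2 ?posrE ?divr_gt0//; have := r10; lra.
have tail (g : {set V} -> R) :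
    (forall (S : {set V}) x y, #|S| = #|K| -> `|g (tperm x y @: S) - g S| <= r^-1) ->
    avg (fun s : {perm V} =>
      (avg (fun s' : {perm V} => g (s' @: K)) + 2 * r ^+ 2 <= g (s @: K))%R%:R) <=
    expR (- r ^+ 2).
  move=> g_swap; apply: le_trans (subset_tail c38 g_swap _ (erefl #|K|)) _.
  rewrite ler_expR -/k kE le_eqVlt; apply/orP; left; apply/eqP.
  by field; rewrite gt_eqF.
have swap (S : {set V}) x y : #|S| = #|K| ->
    `|l * max_cut W (tperm x y @: S) - l * max_cut W S| <= r^-1.
  move=> SK; rewrite -mulrBr normrM (ger0_norm (ltW l0)).
  apply: le_trans (ler_wpM2l (ltW l0) (max_cut_swap W1 S x y)) _.
  rewrite SK -/k kE le_eqVlt; apply/orP; left; apply/eqP.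
  by rewrite /l; field; rewrite gt_eqF.
have t1 := tail (fun S => l * max_cut W S) swap.
have swapN (S : {set V}) x y : #|S| = #|K| ->
    `|- (l * max_cut W (tperm x y @: S)) - - (l * max_cut W S)| <= r^-1.
  by move=> SK; rewrite -opprD normrN swap.
have t2 := tail (fun S => - (l * max_cut W S)) swapN.
rewrite [leRHS]mulr_natl mulr2n; apply: le_trans (lerD t1 t2); rewrite -avgD.
apply: le_avg => s; rewrite avgN avgZ.
have lt : 2 * r ^+ 2 = l * (k ^+ 2 * (4 / r)).
  by rewrite /l kE; field; rewrite gt_eqF.
have k0 : 0 < k ^+ 2 by rewrite kE !exprn_gt0.
set f := max_cut W (s @: K); set E := avg _ in Mm *.
have -> : (l * E + 2 * r ^+ 2 <= l * f) = (E / k ^+ 2 + 4 / r <= f / k ^+ 2).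
  rewrite lt -mulrDr ler_pM2l// -[RHS](ler_pM2l k0) mulrDr.
  by rewrite ![k ^+ 2 * (_ / k ^+ 2)]mulrC !divfK ?gt_eqF.
have -> : (- (l * E) + 2 * r ^+ 2 <= - (l * f)) = (f / k ^+ 2 <= E / k ^+ 2 - 4 / r).
  rewrite lt -(mulrN l E) -(mulrN l f) -mulrDr ler_pM2l// -[RHS](ler_pM2l k0) mulrBr.
  rewrite ![k ^+ 2 * (_ / k ^+ 2)]mulrC !divfK ?gt_eqF//.
  by apply/idP/idP; lra.
move: Mm; set F := f / _; set G := E / _ => Mm.
have h10 : 10 / r = 6 / r + 4 / r by rewrite -mulrDl -natrD.
(* A deviation beyond [10 / r] forces one of the two tail events, as otherwise the value lies within
   [4 / r] of its mean. *)
have [|h] := boolP (10 / r < `|F - M|); last by rewrite addr_ge0.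
have [h1 _|h1] := boolP (G + 4 / r <= F); first by rewrite lerDl.
have [h2 _|h2] := boolP (F <= G - 4 / r); first by rewrite lerDr.
move: h1 h2; rewrite -!ltNge h10; move: Mm; rewrite ler_norml => /andP[Mm1 Mm2] h1 h2.
by case: (ger0P (F - M)) => _ h; exfalso; lra.
Qed.

End MaxCutDeviation.

(** * Cut distance of induced subgraphs *)

Lemma prob_ksubset_avg (R : realType) (V : finType) (K : {set V}) (E : pred {set V}) :
  prob_ksubset R #|K| E = avg (fun s : {perm V} => (E (s @: K))%:R).
Proof.
pose O := [set S : {set V} | #|S| == #|K|].
have O0 : (0 : R) < #|O|%:R by rewrite ltr0n; apply/card_gt0P; exists K; rewrite inE.
have cE : #|[set S : {set V} | (#|S| == #|K|) && E S]|%:R = \sum_(S in O) (E S)%:R :> R.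
  rewrite -sumr_const [LHS]big_mkcond [RHS]big_mkcond /=; apply: eq_bigr => S _.
  by rewrite !inE; case: (_ == _) => //=; case: (E S).
rewrite /prob_ksubset cE -/O; apply: (mulIf (lt0r_neq0 O0)).
rewrite divfK ?gt_eqF// mulr_natr -sumr_const.
rewrite -[LHS](avg_cst _ (perm_card V)).
(* Relabelling permutes the subsets of this size, so the count is unchanged; on average over [s],
   each [S] contributes as much as [K]. *)
rewrite (eq_avg (g := fun s : {perm V} => \sum_(S in O) (E (s @: S))%:R)) => [|s].
  rewrite avg_sum; apply: eq_bigr => S; rewrite inE => /eqP.
  exact: (avg_perm_card (fun S => (E S)%:R)).
rewrite (reindex_inj (imset_inj (@perm_inj _ s))); apply: eq_bigl => S.
by rewrite !inE card_imset//; exact: perm_inj.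
Qed.

Section CutDistance.
Variables (R : realType) (U V : finType) (h : U -> V).
Hypothesis h_inj : injective h.
Variables (G1 G2 : wgraph R V) (H1 H2 : wgraph R U).
Hypothesis GH1 : forall i j, edgeweight H1 i j = edgeweight G1 (h i) (h j).
Hypothesis GH2 : forall i j, edgeweight H2 i j = edgeweight G2 (h i) (h j).

Let w a b : R := (edgeweight G1 a b - edgeweight G2 a b) / 2.
Local Notation im := (h @: setT).
Local Notation w' := (fun a b => - w a b).

Let edge_sumB (A B : {set U}) : edge_sum H1 A B - edge_sum H2 A B =
  2 * \sum_(a in h @: A) \sum_(b in h @: B) w a b.
Proof.
rewrite -sumrB mulr_sumr big_imset /=; last by move=> ? ? _ _; exact: h_inj.
apply: eq_bigr => i _; rewrite -sumrB mulr_sumr big_imset /=; last by move=> ? ? _ _; exact: h_inj.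
by apply: eq_bigr => j _; rewrite GH1 GH2 /w; lra.
Qed.

Let imI (A : {set U}) : h @: A :&: im = h @: A.
Proof. by apply/setIidPl/imsetS/subsetT. Qed.

Let imI_pre (A : {set V}) : h @: (h @^-1: A) = A :&: im.
Proof.
apply/setP => a; rewrite inE; apply/imsetP/andP => [[i]|[aA /imsetP[i _ ai]]].
  by rewrite inE => iA ->; rewrite iA imset_f.
by exists i; rewrite // inE -ai.
Qed.

Let sumN (A B : {set V}) :
  \sum_(a in A) \sum_(b in B) - w a b = - \sum_(a in A) \sum_(b in B) w a b.
Proof. by rewrite -sumrN; apply: eq_bigr => a _; rewrite sumrN. Qed.

(** The absolute value is split between [w] and [- w]. Halving the difference keeps it in [-1, 1]
    for edgeweights in [-1, 1], whence the factor 2. The embedding [h] is to be the identity for the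
    graphs themselves and [val] for induced subgraphs. *)
Lemma cut_dist_max_cut : cut_dist H1 H2 =
  2 * Num.max (max_cut w im / #|U|%:R ^+ 2) (max_cut w' im / #|U|%:R ^+ 2).
Proof.
have u0 : (0 : R) <= (#|U|%:R ^+ 2)^-1 by rewrite invr_ge0 exprn_ge0.
pose X (A B : {set V}) := \sum_(a in A :&: im) \sum_(b in B :&: im) w a b.
have Xle A B : X A B <= max_cut w im := fmax_ub _ _ (A, B).
have Xge A B : - X A B <= max_cut w' im by rewrite -sumN; exact: (fmax_ub _ _ (A, B)).
have m0 : 0 <= Num.max (max_cut w im / #|U|%:R ^+ 2) (max_cut w' im / #|U|%:R ^+ 2).
  by rewrite le_max mulr_ge0// max_cut_ge0.
have termE (A B : {set U}) : 1 / #|U|%:R ^+ 2 * `|edge_sum H1 A B - edge_sum H2 A B| =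
    2 * (`|X (h @: A) (h @: B)| / #|U|%:R ^+ 2).
  by rewrite edge_sumB /X !imI normrM (@ger0_norm _ 2)// div1r mulrC mulrA.
apply/le_anti/andP; split.
  apply/bigmax_le => [|A _]; first by rewrite mulr_ge0.
  apply/bigmax_le => [|B _]; first by rewrite mulr_ge0.
  rewrite termE ler_pM2l// le_max; have := Xle (h @: A) (h @: B).
  have := Xge (h @: A) (h @: B).
  by case: (ger0P (X _ _)) => _ h1 h2; apply/orP; [left|right]; rewrite ler_wpM2r.
(* Only the traces on the image of [h] matter, and these are images of preimages. *)
have big (A B : {set V}) : 2 * (`|X A B| / #|U|%:R ^+ 2) <= cut_dist H1 H2.
  have -> : X A B = X (h @: (h @^-1: A)) (h @: (h @^-1: B)).
    by rewrite /X !imI !imI_pre.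
  rewrite -termE /cut_dist.
  by apply: le_trans (le_bigmax _ _ (h @^-1: A)); exact: le_bigmax.
have maxle z : (exists A B, z <= `|X A B|) -> 2 * (z / #|U|%:R ^+ 2) <= cut_dist H1 H2.
  by move=> [A [B zX]]; apply: le_trans (big A B); rewrite ler_pM2l// ler_wpM2r.
have ex1 : exists A B, max_cut w im <= `|X A B|.
  by rewrite /max_cut /fmax; set p := Order.arg_max _ _ _; exists p.1, p.2; exact: ler_norm.
have ex2 : exists A B, max_cut w' im <= `|X A B|.
  rewrite /max_cut /fmax; set p := Order.arg_max _ _ _; exists p.1, p.2.
  by rewrite sumN -(normrN (X _ _)); exact: ler_norm.
by rewrite /Num.max; case: ifP => _; exact: maxle.
Qed.
End CutDistance.

Lemma max_dist_le (R : realType) (x y x' y' e : R) :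
  `|x - x'| <= e -> `|y - y'| <= e -> `|Num.max x y - Num.max x' y'| <= e.
Proof.
rewrite !ler_norml => /andP[a b] /andP[c d].
by case: (leP x y) => ?; case: (leP x' y') => ?; apply/andP; split; lra.
Qed.

Theorem theorem2p10 (R : realType) (V : finType) (G1 G2 : wgraph R V)
    (hG1 : forall i j : V, -1 <= edgeweight G1 i j <= 1)
    (hG2 : forall i j : V, -1 <= edgeweight G2 i j <= 1)
    (k : nat) (hk0 : (0 < k)%N) (hkV : (k <= #|V|)%N) :
  1 - 2 * expR (- Num.sqrt (k%:R : R) / 8) <=
  prob_ksubset R k (fun S : {set V} =>
    `| cut_dist (induced_wgraph G1 S) (induced_wgraph G2 S) - cut_dist G1 G2 |
      <= 20 / (k%:R `^ (1 / 4))).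
Proof.
pose r : R := k%:R `^ (1 / 4).
have k0 : (0 : R) < k%:R by rewrite ltr0n.
have r0 : 0 < r by rewrite powR_gt0.
have r4 : r ^+ 4 = k%:R.
  by rewrite -powR_mulrn ?powR_ge0// -powRrM mul1r mulVf// powRr1 ?ltW.
have sqrtE : Num.sqrt (k%:R : R) = r ^+ 2.
  by rewrite -r4 -[4%N]/(2 * 2)%N exprM sqrtr_sqr ger0_norm ?exprn_ge0 ?ltW.
rewrite sqrtE -/r.
have [K _ Kk] : exists2 K : {set V}, K \subset [set: V] & #|K| = k.
  have : (k <= #|[set: V]|)%N by rewrite cardsT.
  case/card_geqP => s [us sk _].
  by exists [set x in s]; rewrite ?subsetT// cardsE -sk; exact/card_uniqP.
rewrite -Kk prob_ksubset_avg.
pose w a b : R := (edgeweight G1 a b - edgeweight G2 a b) / 2.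
pose w' a b : R := - w a b.
have w1 a b : `|w a b| <= 1.
  have := hG1 a b; have := hG2 a b => /andP[? ?] /andP[? ?].
  by rewrite ler_norml /w; apply/andP; split; lra.
have w'1 a b : `|w' a b| <= 1 by rewrite normrN.
pose nc (W : V -> V -> R) (S : {set V}) := max_cut W S / #|S|%:R ^+ 2.
have dV : cut_dist G1 G2 = 2 * Num.max (nc w setT) (nc w' setT).
  rewrite (@cut_dist_max_cut R V V id (@inj_id V) G1 G2)//.
  by rewrite imset_id /nc cardsT.
have dS (S : {set V}) : cut_dist (induced_wgraph G1 S) (induced_wgraph G2 S) =
    2 * Num.max (nc w S) (nc w' S).
  rewrite (@cut_dist_max_cut R _ V val val_inj G1 G2)//.
  have -> : [set val x | x in [set: {x : V | x \in S}]] = S.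
    apply/setP => x; apply/imsetP/idP => [[y _ ->]|xS]; first exact: (valP y).
    by exists (exist _ x xS).
  by rewrite card_sig /nc; congr (2 * Num.max (_ / _%:R ^+ 2) (_ / _%:R ^+ 2)); apply: eq_card.
have nc0 W S : 0 <= nc W S by rewrite divr_ge0 ?max_cut_ge0 ?exprn_ge0.
have nc1 (W : V -> V -> R) S : (forall a b, `|W a b| <= 1) -> nc W S <= 1.
  (* An empty [S] is normalized by 0, and the quotient is then 0. *)
  move=> W1; have [S0|S0] := posnP #|S|.
    by rewrite /nc S0 expr0n invr0 mulr0.
  by rewrite ler_pdivrMr ?exprn_gt0 ?ltr0n// mul1r max_cut_le.
have E20 : 20 / r = 2 * (10 / r) by rewrite mulrA -natrM.
have good (S : {set V}) : `|nc w S - nc w setT| <= 10 / r -> `|nc w' S - nc w' setT| <= 10 / r ->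
    `|cut_dist (induced_wgraph G1 S) (induced_wgraph G2 S) - cut_dist G1 G2| <= 20 / r.
  move=> h1 h2; rewrite dV dS -mulrBr normrM ger0_norm// E20 ler_pM2l//.
  exact: max_dist_le.
have P0 := perm_card V.
(* For [r <= 10] the bound holds for every subset: normalized values lie in [0, 1] and
   [10 / r >= 1]. *)
have [r10|r10] := leP r 10.
  apply: (@le_trans _ _ 1); first by rewrite gerBl mulr_ge0 ?expR_ge0.
  apply: avg_ge_cst P0 _ => s.
  have le1 : 1 <= 10 / r by rewrite ler_pdivlMr// mul1r.
  have dist1 (W : V -> V -> R) S S' : (forall a b, `|W a b| <= 1) -> `|nc W S - nc W S'| <= 10 / r.
    move=> W1; apply: le_trans le1; rewrite ler_norml.
    have := nc0 W S; have := nc1 W S W1; have := nc0 W S'; have := nc1 W S' W1.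
    by move=> *; apply/andP; split; lra.
  by rewrite good ?dist1.
rewrite -Kk in r4.
have dev1 := max_cut_deviation w1 (ltW r10) r4.
have dev2 := max_cut_deviation w'1 (ltW r10) r4.
(* Two tails for each of [w] and [w'] give [4 expR (- r ^ 2)]; as [r >= 10], the factor
   [expR (- 7 r ^ 2 / 8)] is at most [1 / 2], which leaves [2 expR (- r ^ 2 / 8)]. *)
apply: (@le_trans _ _ (1 - 4 * expR (- r ^+ 2))).
  rewrite lerD2l lerN2.
  have -> : expR (- r ^+ 2) = expR (- r ^+ 2 / 8) * expR (- (7 / 8 * r ^+ 2)).
    by rewrite -expRD; congr expR; field.
  set e := expR (_ / 8); have e0 : 0 < e := expR_gt0 _.
  suff : expR (- (7 / 8 * r ^+ 2)) <= 2^-1.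
    by move=> /(ler_wpM2l (ltW e0)); lra.
  rewrite expRN lef_pV2 ?posrE ?expR_gt0//.
  apply: le_trans (expR_ge1Dx _).
  have : 10 <= r ^+ 2 by rewrite expr2; nra.
  lra.
have := lerD dev1 dev2; rewrite -avgD => h.
(* Union bound: the indicator of the good event is at least 1 minus those of the two bad events. *)
apply: (@le_trans _ _ (1 - avg (fun s : {perm V} =>
   (10 / r < `|nc w (s @: K) - nc w setT|)%R%:R +
   (10 / r < `|nc w' (s @: K) - nc w' setT|)%R%:R))).
  rewrite lerD2l lerN2.
  have -> : 4 * expR (- r ^+ 2) = 2 * expR (- r ^+ 2) + 2 * expR (- r ^+ 2) by lra.
  apply: le_trans h; apply: le_avg => s.
  by rewrite /nc cardsT card_imset//; exact: perm_inj.
rewrite -[X in X - _](avg_cst _ P0) -avgB; apply: le_avg => s.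
have [h1|h1] := ltP (10 / r) `|nc w (s @: K) - nc w setT|.
  by rewrite opprD addrA subrr add0r; apply: le_trans (ler0n _ _); rewrite oppr_le0.
have [h2|h2] := ltP (10 / r) `|nc w' (s @: K) - nc w' setT|.
  by rewrite add0r subrr.
by rewrite addr0 subr0 good.
Qed.
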